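(* Let $a,b$ be complex numbers, let $f_3(z,a,b)=\sum_{n\ge0}c(n,3,a,b)z^n$ be the unique formal power series with $f_3=1+azf_3+bz^3f_3^2$, and $d_1^{(3)}(N,a,b)=\det\big(c(i+j+1,3,a,b)\big)_{i,j=0}^{N-1}$. Then $$d_1^{(3)}(3n,a,b)=(-1)^nb^{3n^2}\ (n\ge0),\qquad d_1^{(3)}(3n+1,a,b)=(-1)^n(n+1)ab^{3n^2+2n}\ (n\ge0),$$ $$d_1^{(3)}(3n-1,a,b)=(-1)^{n-1}nab^{3n^2-2n}\ (n\ge1).$$
   Context: The determinant of a $0\times0$ matrix is $1$. *)

(* Defs.v *)
From mathcomp Require Import all_boot all_order all_algebra.
Set Implicit Arguments.
Unset Strict Implicit.
Unset Printing Implicit Defensive.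
Import GRing.Theory.
Local Open Scope ring_scope.

(* A formal power series is its coefficient sequence; equality of series is
   pointwise equality [=1]. *)
Definition fps (K : nzRingType) := nat -> K.

Section FormalPowerSeries.
Variable K : nzRingType.
Implicit Types (f g : fps K) (a b : K).

Definition fps_one : fps K := fun n => (n == 0%N)%:R.
Definition fps_zpow (k : nat) : fps K := fun n => (n == k)%:R.
Definition fps_add f g : fps K := fun n => f n + g n.
Definition fps_scale a f : fps K := fun n => a * f n.
Definition fps_mul f g : fps K := fun n => \sum_(i < n.+1) f i * g (n - i)%N.

(* 1 + a z f + b z^3 f^2 *)
Definition f3_rhs a b f : fps K :=
  fps_add fps_one
    (fps_add (fps_scale a (fps_mul (fps_zpow 1) f))
             (fps_scale b (fps_mul (fps_zpow 3) (fps_mul f f)))).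

Definition is_f3 a b f : Prop := f =1 f3_rhs a b f.

Definition d1 (c : fps K) (N : nat) : K :=
  \det (\matrix_(i < N, j < N) c (i + j + 1)%N).

Lemma fps_mul_zpow_local k f g n :
  (forall i, (i < n)%N -> f i = g i) ->
  fps_mul (fps_zpow k.+1) f n = fps_mul (fps_zpow k.+1) g n.
Proof.
move=> fg; apply: eq_bigr => -[[|i] ltin] _ /=; first by rewrite !mul0r.
by rewrite fg // ltn_subrL /=; case: n ltin {fg}.
Qed.

Lemma f3_rhs_local a b f g n :
  (forall i, (i < n)%N -> f i = g i) -> f3_rhs a b f n = f3_rhs a b g n.
Proof.
move=> fg; rewrite /f3_rhs /fps_add /fps_scale (fps_mul_zpow_local _ fg).
congr (_ + (_ + _ * _)); apply: fps_mul_zpow_local => m ltmn.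
apply: eq_bigr => i _; rewrite !fg //.
  by apply: leq_ltn_trans ltmn; rewrite leq_subr.
by apply: leq_trans ltmn.
Qed.

(* Existence and uniqueness of the series f_3. *)
Lemma f3_exists_unique a b :
  exists2 f, is_f3 a b f & forall g, is_f3 a b g -> g =1 f.
Proof.
pose u m := iter m (f3_rhs a b) (fun=> 0).
have uS m p n : (n < m)%N -> u (m + p)%N n = u m n.
  elim: m n => // m IHm n ltnm; rewrite addSn; apply: f3_rhs_local => i ltin.
  by apply: IHm; apply: leq_trans ltin _.
pose f n := u n.+1 n.
have fE : is_f3 a b f.
  move=> n; rewrite /f -(uS _ 1%N) // addn1; apply: f3_rhs_local => i ltin.
  by rewrite -[LHS]/(u n.+1 i) -[n.+1](subnKC (leqW ltin)) uS.
exists f => // g gE; elim/ltn_ind => n IHn.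
by rewrite gE fE; apply: f3_rhs_local.
Qed.

End FormalPowerSeries.

(* Main.v *)
(** The Hankel kernel of a series [g] is [(g(x) - g(y)) / (x - y)], and
    multiplying a kernel by [r(x) r(y)] with [r(0) = 1] keeps all leading
    minors.  Taking [r = 1 / f = 1 - a z - b z^3 f] turns the kernel of
    [z^k f] into that of the pair [(z^k, 1 / f)], which is block diagonal: a
    [k x k] anti-triangular block and [b] times the Hankel kernel of
    [z^(3 - k) f], up to a corner entry [a] when [k = 0].  Hence, with
    [H k N] the minors of [z^k f],
    [H 1 (N + 3) = - b^(2 N + 2) H 1 N] and
    [H 0 (N + 3) = a b^(N + 2) H 1 (N + 2) - b^(2 N + 3) H 0 N]. *)
Require Import Defs.
From mathcomp Require Import all_boot all_order all_algebra reals complex.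
From mathcomp Require Import ring zify.
Set Implicit Arguments.
Unset Strict Implicit.
Unset Printing Implicit Defensive.
Import GRing.Theory.
Local Open Scope ring_scope.

(** * Leading minors of infinite matrices *)

Section Kernels.
Variable K : comNzRingType.
Implicit Types (p q r g : fps K) (X Y A B : nat -> nat -> K).

Definition mdet N X : K := \det (\matrix_(i < N, j < N) X i j).

Lemma eq_mdet N X Y : X =2 Y -> mdet N X = mdet N Y.
Proof. by move=> XY; congr (\det _); apply/matrixP=> i j; rewrite !mxE XY. Qed.

Lemma mdet_tr N X : mdet N (fun i j => X j i) = mdet N X.
Proof.
by rewrite /mdet -det_tr; congr (\det _); apply/matrixP=> i j; rewrite !mxE.
Qed.

Lemma mdet0 X : mdet 0 X = 1.
Proof. exact: det_mx00. Qed.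

Lemma mdet1 X : mdet 1 X = X 0%N 0%N.
Proof. by rewrite /mdet det_mx11 mxE. Qed.

Lemma mdet2 X : mdet 2 X = X 0 0 * X 1 1 - X 0 1 * X 1 0.
Proof.
rewrite /mdet (expand_det_row _ ord0) !big_ord_recl big_ord0 /cofactor.
by rewrite !det_mx11 !mxE /=; ring.
Qed.

Lemma mdet3 X : mdet 3 X =
  X 0 0 * (X 1 1 * X 2 2 - X 1 2 * X 2 1)
  - X 0 1 * (X 1 0 * X 2 2 - X 1 2 * X 2 0)
  + X 0 2 * (X 1 0 * X 2 1 - X 1 1 * X 2 0).
Proof.
rewrite /mdet (expand_det_row _ ord0) !big_ord_recl big_ord0 /cofactor.
rewrite !(expand_det_row _ ord0) !big_ord_recl !big_ord0 /cofactor.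
by rewrite !det_mx11 !mxE /=; ring.
Qed.

Lemma mdetZ N s X : mdet N (fun i j => s * X i j) = s ^+ N * mdet N X.
Proof.
by rewrite /mdet -detZ; congr (\det _); apply/matrixP=> i j; rewrite !mxE.
Qed.

Definition block_kernel k A B (i j : nat) : K :=
  if (i < k)%N then (if (j < k)%N then A i j else 0)
  else if (j < k)%N then 0 else B (i - k)%N (j - k)%N.

Lemma mdet_block k m A B :
  mdet (k + m) (block_kernel k A B) = mdet k A * mdet m B.
Proof.
rewrite /mdet -(det_ublock _ 0); congr (\det _).
apply/matrixP=> i j; rewrite [LHS]mxE /block_kernel.
case: (split_ordP i) => i' ->; case: (split_ordP j) => j' -> /=;
  rewrite ?block_mxEul ?block_mxEur ?block_mxEdl ?block_mxEdr !mxE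
    ?ltn_ord ?ltnNge ?leq_addr //= ?addKn //.
Qed.

(** The first row is that of [X] plus [s] times a unit vector. Linearity in this row, then expansion
    along the unit row, gives the two terms. *)
Lemma mdet_corner N X s :
  mdet N.+1 (fun i j => X i j + (if (i == 0%N) && (j == 0%N) then s else 0))
  = mdet N.+1 X + s * mdet N (fun i j => X i.+1 j.+1).
Proof.
set Z := (fun i j => _ + _).
pose E i j := if i == 0%N then (j == 0%N)%:R else X i j.
have -> : mdet N.+1 Z = 1 * mdet N.+1 X + s * mdet N.+1 E.
  apply: (@determinant_multilinear _ _ _ _ _ ord0).
  - apply/rowP=> j; rewrite !mxE /Z /E /= mul1r; congr (_ + _).
    by case: eqP; rewrite ?mulr1 ?mulr0.
  - by apply/matrixP=> i j; rewrite !mxE /Z /= addr0.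
  - by apply/matrixP=> i j; rewrite !mxE /Z /E /= addr0.
rewrite mul1r; congr (_ + s * _).
rewrite [in LHS]/mdet (expand_det_row _ ord0) big_ord_recl big1 => [|j _].
  rewrite !mxE /E /= mul1r addr0 /cofactor expr0 mul1r.
  by congr (\det _); apply/matrixP=> i j; rewrite !mxE.
by rewrite !mxE /E /= mul0r.
Qed.

(** * Products of series and Bezoutian kernels *)

Lemma fps_mulC p q : fps_mul p q =1 fps_mul q p.
Proof.
move=> n; rewrite /fps_mul (reindex_inj rev_ord_inj) /=.
by apply: eq_bigr => i _; rewrite subSS subKn 1?mulrC // -ltnS.
Qed.

Lemma eq_fps_mull p q r : p =1 q -> fps_mul p r =1 fps_mul q r.
Proof. by move=> pq n; apply: eq_bigr => i _; rewrite pq. Qed.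

Lemma fps_mul1l p : fps_mul (fps_one K) p =1 p.
Proof.
move=> n; rewrite /fps_mul big_ord_recl /fps_one mul1r subn0.
by rewrite big1 ?addr0 // => l _; rewrite mul0r.
Qed.

Definition rmulx r X (i j : nat) : K := fps_mul (X^~ j) r i.

(** Multiplication by [r(x)] acts on the rows as a lower triangular Toeplitz matrix with diagonal
    [r 0 = 1], so it restricts to leading blocks. *)
Lemma mdet_rmulx r N X : r 0%N = 1 -> mdet N (rmulx r X) = mdet N X.
Proof.
move=> r0.
pose L : 'M[K]_N := \matrix_(i, k) (if (k <= i)%N then r (i - k)%N else 0).
have detL : \det L = 1.
  rewrite det_trig => [|]; last first.
    by apply/is_trig_mxP=> i j ltij; rewrite mxE leqNgt ltij.
  by apply: big1 => i _; rewrite mxE leqnn subnn r0.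
rewrite /mdet -[RHS]mul1r -detL -det_mulmx; congr (\det _).
apply/matrixP=> i j; rewrite !mxE /rmulx /fps_mul.
rewrite (big_ord_widen N (fun k => X k j * r (i - k)%N)) ?ltn_ord //.
rewrite big_mkcond; apply: eq_bigr => k _; rewrite !mxE ltnS.
by case: ifP => _; rewrite ?mul0r // mulrC.
Qed.

(* The coefficients of (x - y) X(x, y). *)
Definition diffxy X (i j : nat) : K :=
  (if i is i'.+1 then X i' j else 0) - (if j is j'.+1 then X i j' else 0).

Lemma diffxy_tr X i j : diffxy (fun i j => X j i) i j = - diffxy X j i.
Proof. by rewrite /diffxy opprB. Qed.

Lemma diffxy_rmulx r X i j : diffxy (rmulx r X) i j = rmulx r (diffxy X) i j.
Proof.
rewrite /diffxy /rmulx /fps_mul.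
under [RHS]eq_bigr do rewrite mulrBl.
rewrite sumrB; congr (_ - _).
  by case: i => [|i]; rewrite [RHS]big_ord_recl /= mul0r add0r ?big_ord0.
by case: j => [|j] //; rewrite big1 // => k _; rewrite mul0r.
Qed.

(** Division by [x - y] is unambiguous: the coefficient at [(0, j + 1)] gives row [0], and the one
    at [(i + 1, j + 1)] gives row [i + 1] from row [i]. *)
Lemma diffxy_inj X Y : diffxy X =2 diffxy Y -> X =2 Y.
Proof.
move=> XY; elim=> [|i IHi] j.
  by have := XY 0%N j.+1; rewrite /diffxy !sub0r => /oppr_inj.
by have := XY i.+1 j.+1; rewrite /diffxy IHi => /addrI/oppr_inj.
Qed.

(* X(x, y) = (p(x) q(y) - q(x) p(y)) / (x - y). *)
Definition bezoutian p q X :=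
  forall i j, diffxy X i j = p i * q j - q i * p j.

Lemma mdet_bezoutian_mul p q r X Y N : r 0%N = 1 ->
  bezoutian p q X -> bezoutian (fps_mul p r) (fps_mul q r) Y ->
  mdet N Y = mdet N X.
Proof.
move=> r0 hX hY.
(* Transposing between two uses of [rmulx] produces the factor [r(y)] as well; it remains to see
   that [Y] is [r(x) r(y) X], which is checked after multiplying by [x - y]. *)
rewrite -mdet_tr -(mdet_rmulx N X r0) -[RHS]mdet_tr -[RHS](mdet_rmulx _ _ r0).
apply: eq_mdet => i j; move: i j; apply: diffxy_inj => i j.
rewrite diffxy_tr hY diffxy_rmulx /rmulx /fps_mul opprB.
rewrite mulrC [X in _ - X]mulrC !big_distrl -sumrB /=.
apply: eq_bigr => k _.
rewrite (diffxy_tr (rmulx r X)) diffxy_rmulx /rmulx /fps_mul mulNr.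
under [in RHS]eq_bigr do rewrite hX.
rewrite !big_distrr -sumrB big_distrl -sumrN /=.
by apply: eq_bigr => l _; ring.
Qed.

(** [(x^n - y^n) / (x - y)] is the sum of [x^i y^j] over [i + j + 1 = n]; the constant term of [g]
    cancels. *)
Lemma bezoutian_hankel g : bezoutian g (fps_one K) (fun i j => g (i + j).+1).
Proof.
move=> [|i] [|j]; rewrite /diffxy /fps_one /= ?addn0 ?addnS; ring.
Qed.

(** The monomial [z^m] of [r] contributes [(x^k y^m - x^m y^k) / (x - y)]. Both exponents are below
    [k] in all its terms if [m < k], and at least [k] if [m > k]; hence the two blocks. *)
Lemma bezoutian_zpow k r :
  bezoutian (fps_zpow K k) r
    (block_kernel k
       (fun i j => if (i + j + 1 < k)%N then 0 else r (i + j + 1 - k)%N)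
       (fun i j => - r (i + j + k).+1)).
Proof.
have rE m n : m = n -> r m = r n by move->.
move=> i j; rewrite /diffxy /fps_zpow /block_kernel.
case: i => [|i]; case: j => [|j] /=;
  repeat (case: ifP => ?); try (exfalso; lia);
  repeat (case: eqP => ?); try (exfalso; lia);
  (* Arguments of [r] that are equal by arithmetic are made syntactically equal, so that [ring] sees
     one atom. *)
  repeat match goal with |- context [r ?x] =>
    match goal with |- context [r ?y] =>
      tryif constr_eq x y then fail else rewrite (rE x y ltac:(lia)) end end;
  rewrite ?mulr0n ?mulr1n; ring.
Qed.

(** * Multiplication by powers of [z] and shifted Hankel minors *)

Definition shift1 g : fps K := fun n => if n is m.+1 then g m else 0.

Lemma fps_mul_shift k p q n :
  fps_mul (iter k shift1 p) q n = iter k shift1 (fps_mul p q) n.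
Proof.
elim: k n => [//|k IHk] [|n] /=.
  by rewrite /fps_mul big_ord_recl big_ord0 mul0r addr0.
rewrite -IHk /fps_mul big_ord_recl mul0r add0r.
by apply: eq_bigr => i _.
Qed.

Lemma shift_one k n : iter k shift1 (fps_one K) n = fps_zpow K k n.
Proof. by elim: k n => [|k IHk] [|n] //=; rewrite IHk. Qed.

Lemma eq_shift k p q : p =1 q -> iter k shift1 p =1 iter k shift1 q.
Proof. by move=> pq; elim: k => [|k IHk] [|n] /=. Qed.

(** Indices start at [1]: the corner entry is [g 1] for [k = 0] and [g 0] for [k = 1]. *)
Definition hankel k g N := mdet N (fun i j => iter k shift1 g (i + j).+1).

Lemma hankel_shift k m g r : r 0%N = 1 -> fps_mul g r =1 fps_one K ->
  hankel k g (k + m) =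
  mdet k (fun i j => if (i + j + 1 < k)%N then 0 else r (i + j + 1 - k)%N) *
  mdet m (fun i j => - r (i + j + k).+1).
Proof.
move=> r0 gr; rewrite -mdet_block /hankel; symmetry.
apply: (mdet_bezoutian_mul _ r0 (bezoutian_hankel (iter k shift1 g))) => i j.
rewrite bezoutian_zpow !fps_mul_shift !(eq_shift k gr) !shift_one.
by rewrite !fps_mul1l.
Qed.

End Kernels.

(** * Recurrences for the Hankel minors of [z^k f_3] *)

Section F3.
Variables (K : comNzRingType) (a b : K) (c : fps K).
Hypothesis hc : is_f3 a b c.

(** The coefficients of [1 - a z - b z^3 f], found by dividing the equation of [f] by [f]. *)
Definition f3_inv : fps K := fun n =>
  match n with 0 => 1 | 1 => - a | 2 => 0 | m.+3 => - b * c m end.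

Lemma fps_mul_zpow k g n :
  fps_mul (fps_zpow K k) g n = iter k (@shift1 K) g n.
Proof.
rewrite -(eq_fps_mull _ (shift_one K k)) fps_mul_shift.
exact/eq_shift/fps_mul1l.
Qed.

Lemma f3_rec n : c n = (n == 0)%:R + (a * shift1 c n +
  b * iter 3 (@shift1 K) (fps_mul c c) n).
Proof.
by rewrite {1}hc /f3_rhs /fps_add /fps_scale !fps_mul_zpow.
Qed.

Lemma f3_mul_inv : fps_mul c f3_inv =1 fps_one K.
Proof.
move=> n; rewrite fps_mulC.
case: n => [|[|[|n]]]; rewrite /fps_mul.
- by rewrite big_ord_recl big_ord0 subn0 f3_rec /fps_one /=; ring.
- rewrite !big_ord_recl big_ord0 subn0 subnn [c 1]f3_rec /fps_one /=; ring.
- rewrite !big_ord_recl big_ord0 subn0 [c 2]f3_rec /fps_one /=; ring.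
rewrite 3!big_ord_recl /= subn0 [c n.+3]f3_rec /fps_one /= subSS subn0.
have -> : \sum_(i < n.+1) - b * c (0 + i)%N *
    c (n.+3 - bump 0 (bump 0 (bump 0 i)))%N = - b * fps_mul c c n.
  by rewrite big_distrr /=; apply: eq_bigr => l _; rewrite mulrA.
ring.
Qed.

Lemma hankel1S m : hankel 1 c m.+1 = b ^+ m * hankel 2 c m.
Proof.
rewrite (hankel_shift 1 m (r := f3_inv) _ f3_mul_inv) // mdet1 mul1r -mdetZ.
by apply: eq_mdet => i j; rewrite addn1; case: (i + j)%N => [|n] /=; ring.
Qed.

(** The sign is the determinant of the block with rows [(0, 1)] and [(1, -a)]. *)
Lemma hankel2SS m : hankel 2 c m.+2 = - b ^+ m * hankel 1 c m.
Proof.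
rewrite (hankel_shift 2 m (r := f3_inv) _ f3_mul_inv) // mdet2 /=.
rewrite mul0r sub0r mulr1 mulN1r mulNr -mdetZ; congr (- _).
by apply: eq_mdet => i j; rewrite addn2 /=; ring.
Qed.

Lemma hankel3SSS m : hankel 3 c m.+3 = - b ^+ m * hankel 0 c m.
Proof.
rewrite (hankel_shift 3 m (r := f3_inv) _ f3_mul_inv) // mdet3 /=.
rewrite !mul0r subrr !add0r mulr1 mul1r mulN1r mulNr -mdetZ; congr (- _).
by apply: eq_mdet => i j; rewrite addn3 /=; ring.
Qed.

Lemma hankel0S m :
  hankel 0 c m.+1 = b ^+ m.+1 * hankel 3 c m.+1 + a * b ^+ m * hankel 1 c m.
Proof.
rewrite (hankel_shift 0 m.+1 (r := f3_inv) _ f3_mul_inv) // mdet0 mul1r.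
rewrite -mulrA -!mdetZ -[mdet m _]/(mdet m (fun i j => b * c (i + j)%N)).
(* Deleting the first row and column from the matrix of [z^3 f] leaves that of [z f]; this is the
   cofactor of the corner entry [a]. *)
have -> : mdet m (fun i j => b * c (i + j)%N) =
    mdet m (fun i j => b * iter 3 (@shift1 K) c (i.+1 + j.+1).+1).
  by apply: eq_mdet => i j; rewrite addnS.
rewrite -(mdet_corner m (fun i j => b * iter 3 (@shift1 K) c (i + j).+1)).
apply: eq_mdet => i j; rewrite addn0 -addn_eq0.
by case: (i + j)%N => [|[|n]] /=; ring.
Qed.

(** The shift goes from [1] to [2] and back to [1]. *)
Lemma hankel1_rec m : hankel 1 c m.+3 = - b ^+ (2 * m + 2) * hankel 1 c m.
Proof.
have -> : (2 * m + 2 = m.+2 + m)%N by lia.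
by rewrite hankel1S hankel2SS exprD; ring.
Qed.

Lemma hankel0_rec m : hankel 0 c m.+3 =
  a * b ^+ m.+2 * hankel 1 c m.+2 - b ^+ (2 * m + 3) * hankel 0 c m.
Proof.
have -> : (2 * m + 3 = m.+3 + m)%N by lia.
by rewrite hankel0S hankel3SSS exprD; ring.
Qed.

(** * Closed forms according to the size modulo 3 *)

Lemma hankel1_mod0 n : hankel 1 c (3 * n) = (-1) ^+ n * b ^+ (3 * n ^ 2 - n).
Proof.
elim: n => [|n IHn]; first by rewrite /hankel mdet0 mulr1.
have -> : (3 * n.+1 = (3 * n).+3)%N by lia.
have -> : (3 * n.+1 ^ 2 - n.+1 = 2 * (3 * n) + 2 + (3 * n ^ 2 - n))%N by nia.
by rewrite hankel1_rec IHn [in RHS]exprD [(-1) ^+ n.+1]exprS; ring.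
Qed.

Lemma hankel1_mod1 n :
  hankel 1 c (3 * n).+1 = (-1) ^+ n * b ^+ (3 * n ^ 2 + n).
Proof.
elim: n => [|n IHn].
  by rewrite muln0 hankel1S /hankel mdet0 !mulr1.
have -> : ((3 * n.+1).+1 = (3 * n).+1.+3)%N by lia.
have -> : (3 * n.+1 ^ 2 + n.+1 = 2 * (3 * n).+1 + 2 + (3 * n ^ 2 + n))%N.
  by nia.
by rewrite hankel1_rec IHn [in RHS]exprD [(-1) ^+ n.+1]exprS; ring.
Qed.

(** The size 2 minor reduces to the coefficient of [z] in [z^2 f], which is [0]. This removes the
    inhomogeneous term of [hankel0_rec] at sizes [3 * n]. *)
Lemma hankel1_mod2 n : hankel 1 c (3 * n).+2 = 0.
Proof.
elim: n => [|n IHn].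
  by rewrite hankel1S /hankel mdet1 /= mulr0.
have -> : ((3 * n.+1).+2 = (3 * n).+2.+3)%N by lia.
by rewrite hankel1_rec IHn mulr0.
Qed.

Lemma hankel0_mod0 n : hankel 0 c (3 * n) = (-1) ^+ n * b ^+ (3 * n ^ 2).
Proof.
elim: n => [|n IHn]; first by rewrite /hankel mdet0 mulr1.
have -> : (3 * n.+1 = (3 * n).+3)%N by lia.
have -> : (3 * n.+1 ^ 2 = 2 * (3 * n) + 3 + 3 * n ^ 2)%N by nia.
by rewrite hankel0_rec hankel1_mod2 IHn [in RHS]exprD [(-1) ^+ n.+1]exprS; ring.
Qed.

Lemma hankel0_mod1 n : hankel 0 c (3 * n).+1 =
  (-1) ^+ n * n.+1%:R * a * b ^+ (3 * n ^ 2 + 2 * n).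
Proof.
elim: n => [|n IHn].
  by rewrite hankel0S /hankel mdet0 mdet1 /= !(mulr0, mulr1, add0r, mul1r).
have -> : ((3 * n.+1).+1 = (3 * n).+1.+3)%N by lia.
rewrite hankel0_rec IHn.
have -> : ((3 * n).+3 = 3 * n.+1)%N by lia.
rewrite hankel1_mod0.
have e1 : (3 * n.+1 ^ 2 + 2 * n.+1 = 3 * n.+1 + (3 * n.+1 ^ 2 - n.+1))%N.
  by nia.
have e2 : (3 * n.+1 ^ 2 + 2 * n.+1 =
  2 * (3 * n).+1 + 3 + (3 * n ^ 2 + 2 * n))%N by nia.
(* Both terms of the recurrence carry the same signed monomial, with coefficients [1] and [n + 1];
   each round adds one copy, whence the linear factor. *)
transitivity ((-1) ^+ n.+1 * a * b ^+ (3 * n.+1 ^ 2 + 2 * n.+1) +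
  (-1) ^+ n.+1 * n.+1%:R * a * b ^+ (3 * n.+1 ^ 2 + 2 * n.+1)); last first.
  by rewrite -(natr1 n.+1); ring.
congr (_ + _); first by rewrite [in RHS]e1 [in RHS]exprD; ring.
by rewrite [in RHS]e2 [in RHS]exprD [(-1) ^+ n.+1]exprS; ring.
Qed.

(** As for [hankel0_mod1], with [hankel1_mod1] feeding the recurrence. The size [3 n - 1] is written
    at [n + 1] to avoid truncated subtraction in it. *)
Lemma hankel0_mod2 n : hankel 0 c (3 * n).+2 =
  (-1) ^+ n * n.+1%:R * a * b ^+ (3 * n.+1 ^ 2 - 2 * n.+1).
Proof.
elim: n => [|n IHn].
  by rewrite hankel0S (hankel1_mod1 0) /hankel mdet2 /=; ring.
have -> : ((3 * n.+1).+2 = (3 * n).+2.+3)%N by lia.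
rewrite hankel0_rec IHn.
have -> : ((3 * n).+4 = (3 * n.+1).+1)%N by lia.
rewrite hankel1_mod1.
have e1 : (3 * n.+2 ^ 2 - 2 * n.+2 =
  (3 * n.+1).+1 + (3 * n.+1 ^ 2 + n.+1))%N by nia.
have e2 : (3 * n.+2 ^ 2 - 2 * n.+2 =
  2 * (3 * n).+2 + 3 + (3 * n.+1 ^ 2 - 2 * n.+1))%N by nia.
transitivity ((-1) ^+ n.+1 * a * b ^+ (3 * n.+2 ^ 2 - 2 * n.+2) +
  (-1) ^+ n.+1 * n.+1%:R * a * b ^+ (3 * n.+2 ^ 2 - 2 * n.+2)); last first.
  by rewrite -(natr1 n.+1); ring.
congr (_ + _); first by rewrite [in RHS]e1 [in RHS]exprD; ring.
by rewrite [in RHS]e2 [in RHS]exprD [(-1) ^+ n.+1]exprS; ring.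
Qed.

Lemma d1E N : d1 c N = hankel 0 c N.
Proof.
by congr (\det _); apply/matrixP=> i j; rewrite !mxE addn1.
Qed.

End F3.

Theorem theorem6p2 (R : realType) (a b : R[i]) (c : fps R[i])
    (hc : is_f3 a b c) :
  [/\ forall n : nat, d1 c (3 * n) = (-1) ^+ n * b ^+ (3 * n ^ 2),
      forall n : nat,
        d1 c (3 * n + 1) = (-1) ^+ n * (n + 1)%:R * a * b ^+ (3 * n ^ 2 + 2 * n)
    & forall n : nat, (1 <= n)%N ->
        d1 c (3 * n - 1) = (-1) ^+ (n - 1) * n%:R * a * b ^+ (3 * n ^ 2 - 2 * n)].
Proof.
split=> [n|n|[//|n] _]; rewrite d1E.
- exact: hankel0_mod0.
- by rewrite !addn1; apply: hankel0_mod1.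
by rewrite mulnSr addnS !subn1 addn2; apply: hankel0_mod2.
Qed.
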